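(* Let $G,H$ be incidence hypergraphs and let $[G,H]_V$ and $\mathrm{vev}_H^G:G\check\Box[G,H]_V\to H$ be as in the context. For every incidence hypergraph $K$ and every homomorphism $\phi:G\check\Box K\to H$ there is a unique homomorphism $\hat\phi:K\to[G,H]_V$ such that $\mathrm{vev}_H^G\circ(G\check\Box\hat\phi)=\phi$.
   Context: An incidence hypergraph $G$ consists of sets $\check V(G),\check E(G),I(G)$ and functions $\varsigma_G:I(G)\to\check V(G)$, $\omega_G:I(G)\to\check E(G)$; a homomorphism is a triple $(\check V\phi,\check E\phi,I\phi)$ with $\varsigma_H\circ I\phi=\check V\phi\circ\varsigma_G$ and $\omega_H\circ I\phi=\check E\phi\circ\omega_G$; $\mathfrak R(G,H)$ is the set of homomorphisms. Incidence box product: $\check V(G\check\Box H)=\check V(G)\times\check V(H)$, $\check E(G\check\Box H)=(\{1\}\times\check E(G)\times\check V(H))\cup(\{2\}\times\check V(G)\times\check E(H))$, $I(G\check\Box H)=(\{1\}\times I(G)\times\check V(H))\cup(\{2\}\times\check V(G)\times I(H))$, $\varsigma(1,x,y)=(\varsigma_Gx,y)$, $\varsigma(2,x,y)=(x,\varsigma_Hy)$, $\omega(1,x,y)=(1,\omega_Gx,y)$, $\omega(2,x,y)=(2,x,\omega_Hy)$; for $\phi,\psi$: $(v,w)\mapsto(\check V\phi(v),\check V\psi(w))$, $(1,x,y)\mapsto(1,\check E\phi(x),\check V\psi(y))$ and $(2,x,y)\mapsto(2,\check V\phi(x),\check E\psi(y))$ on edges, $(1,x,y)\mapsto(1,I\phi(x),\check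 V\psi(y))$ and $(2,x,y)\mapsto(2,\check V\phi(x),I\psi(y))$ on incidences. $\check V^\diamond(\{1\})$: one vertex $1$ only; $I^\diamond(\{1\})$: one vertex $1$, one edge $1$, one incidence $1$ joining them; $Y(y):\check V^\diamond(\{1\})\to I^\diamond(\{1\})$ the inclusion of the vertex. $\check r_G:G\check\Box\check V^\diamond(\{1\})\to G$ is the isomorphism $(v,1)\mapsto v$, $(1,e,1)\mapsto e$, $(1,i,1)\mapsto i$. Box exponential $[G,H]_V$: vertices $\mathfrak R(G,H)$; edges the set of all functions $\check V(G)\to\check E(H)$; incidences $\mathfrak R(G\check\Box I^\diamond(\{1\}),H)$; $\varsigma(\psi)=\psi\circ(G\check\Box Y(y))\circ\check r_G^{-1}$; $\omega(\psi)$ is the function $v\mapsto\check E(\psi)(2,v,1)$. Evaluation $\mathrm{vev}$: $\check V(\mathrm{vev})(v,\phi)=\check V(\phi)(v)$; $\check E(\mathrm{vev})(1,x,\phi)=\check E(\phi)(x)$ for $\phi\in\mathfrak R(G,H)$; $\check E(\mathrm{vev})(2,x,f)=f(x)$ for $f:\check V(G)\to\check E(H)$; $I(\mathrm{vev})(1,x,\phi)=I(\phi)(x)$; $I(\mathrm{vev})(2,x,\varphi)=I(\varphi)(2,x,1)$. *)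

(* Defs.v *)
From Stdlib Require Import FunctionalExtensionality ProofIrrelevance.

Set Implicit Arguments.
Unset Strict Implicit.
Unset Printing Implicit Defensive.

Record ihgraph : Type := IHGraph {
  vert : Type;
  edge : Type;
  inc : Type;
  ivert : inc -> vert; (* varsigma *)
  iedge : inc -> edge  (* omega *)
}.

Record hom (G H : ihgraph) : Type := Hom {
  hvert : vert G -> vert H;
  hedge : edge G -> edge H;
  hinc : inc G -> inc H;
  hom_ivert : forall i, ivert (hinc i) = hvert (ivert i);
  hom_iedge : forall i, iedge (hinc i) = hedge (iedge i)
}.

Arguments Hom {G H}.

Lemma hom_ext (G H : ihgraph) (f g : hom G H) :
  (forall v, hvert f v = hvert g v) ->
  (forall e, hedge f e = hedge g e) ->
  (forall i, hinc f i = hinc g i) -> f = g.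
Proof.
destruct f as [fv fe fi pf qf], g as [gv ge gi pg qg]; simpl.
intros Ev Ee Ei.
apply functional_extensionality in Ev, Ee, Ei; subst gv ge gi.
f_equal; apply proof_irrelevance.
Qed.

Definition hom_id (G : ihgraph) : hom G G :=
  Hom (fun v => v) (fun e => e) (fun i => i)
    (fun _ => eq_refl) (fun _ => eq_refl).

Lemma comp_ivert (G H K : ihgraph) (g : hom H K) (f : hom G H) (i : inc G) :
  ivert (hinc g (hinc f i)) = hvert g (hvert f (ivert i)).
Proof. now rewrite hom_ivert, hom_ivert. Qed.

Lemma comp_iedge (G H K : ihgraph) (g : hom H K) (f : hom G H) (i : inc G) :
  iedge (hinc g (hinc f i)) = hedge g (hedge f (iedge i)).
Proof. now rewrite hom_iedge, hom_iedge. Qed.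

Definition hom_comp (G H K : ihgraph) (g : hom H K) (f : hom G H) : hom G K :=
  Hom (fun v => hvert g (hvert f v))
      (fun e => hedge g (hedge f e))
      (fun i => hinc g (hinc f i))
      (comp_ivert g f) (comp_iedge g f).

(* Incidence box product.  The tags 1 and 2 of the disjoint unions are encoded
   by [inl] and [inr]: (1,x,y) is [inl (x, y)] and (2,x,y) is [inr (x, y)]. *)

Definition box (G H : ihgraph) : ihgraph := {|
  vert := vert G * vert H;
  edge := edge G * vert H + vert G * edge H;
  inc := inc G * vert H + vert G * inc H;
  ivert := fun i =>
    match i with
    | inl (x, y) => (ivert x, y)
    | inr (x, y) => (x, ivert y)
    end;
  iedge := fun i =>
    match i with
    | inl (x, y) => inl (iedge x, y)
    | inr (x, y) => inr (x, iedge y)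
    end
|}.

Section BoxHom.

Variables (G G' H H' : ihgraph) (f : hom G G') (g : hom H H').

Definition box_hvert (p : vert (box G H)) : vert (box G' H') :=
  let (v, w) := p in (hvert f v, hvert g w).

Definition box_hedge (e : edge (box G H)) : edge (box G' H') :=
  match e with
  | inl (x, y) => inl (hedge f x, hvert g y)
  | inr (x, y) => inr (hvert f x, hedge g y)
  end.

Definition box_hinc (i : inc (box G H)) : inc (box G' H') :=
  match i with
  | inl (x, y) => inl (hinc f x, hvert g y)
  | inr (x, y) => inr (hvert f x, hinc g y)
  end.

Lemma box_hom_ivert (i : inc (box G H)) :
  ivert (box_hinc i) = box_hvert (ivert i).
Proof. now destruct i as [[x y]|[x y]]; simpl; rewrite hom_ivert. Qed.

Lemma box_hom_iedge (i : inc (box G H)) :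
  iedge (box_hinc i) = box_hedge (iedge i).
Proof. now destruct i as [[x y]|[x y]]; simpl; rewrite hom_iedge. Qed.

Definition box_hom : hom (box G H) (box G' H') :=
  Hom box_hvert box_hedge box_hinc box_hom_ivert box_hom_iedge.

End BoxHom.

(* The incidence hypergraphs V^diamond({1}) and I^diamond({1}). *)

Definition Vdiam1 : ihgraph := {|
  vert := unit;
  edge := Empty_set;
  inc := Empty_set;
  ivert := fun i => match i with end;
  iedge := fun i => match i with end
|}.

Definition Idiam1 : ihgraph := {|
  vert := unit;
  edge := unit;
  inc := unit;
  ivert := fun _ => tt;
  iedge := fun _ => tt
|}.

(* Y(y), the inclusion of the vertex. *)
Definition Yy : hom Vdiam1 Idiam1 :=
  @Hom Vdiam1 Idiam1
    (fun _ => tt) (fun e => match e with end) (fun i => match i with end)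
    (fun i => match i with end) (fun i => match i with end).

Section RightUnit.

Variable G : ihgraph.

Definition runit_vert (p : vert (box G Vdiam1)) : vert G := fst p.

Definition runit_edge (e : edge (box G Vdiam1)) : edge G :=
  match e with
  | inl (x, _) => x
  | inr (_, y) => match y with end
  end.

Definition runit_inc (i : inc (box G Vdiam1)) : inc G :=
  match i with
  | inl (x, _) => x
  | inr (_, y) => match y with end
  end.

Lemma runit_ivert (i : inc (box G Vdiam1)) :
  ivert (runit_inc i) = runit_vert (ivert i).
Proof. now destruct i as [[x y]|[x []]]. Qed.

Lemma runit_iedge (i : inc (box G Vdiam1)) :
  iedge (runit_inc i) = runit_edge (iedge i).
Proof. now destruct i as [[x y]|[x []]]. Qed.

Definition runit : hom (box G Vdiam1) G :=
  Hom runit_vert runit_edge runit_inc runit_ivert runit_iedge.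

Definition runit_inv : hom G (box G Vdiam1) :=
  @Hom G (box G Vdiam1)
    (fun v => (v, tt)) (fun e => inl (e, tt)) (fun i => inl (i, tt))
    (fun _ => eq_refl) (fun _ => eq_refl).

Lemma runitK : hom_comp runit_inv runit = hom_id (box G Vdiam1).
Proof.
apply hom_ext; simpl.
- now intros [v []].
- now intros [[x []]|[x []]].
- now intros [[x []]|[x []]].
Qed.

Lemma runit_invK : hom_comp runit runit_inv = hom_id G.
Proof. now apply hom_ext. Qed.

End RightUnit.

(* The box exponential [G, H]_V. *)
Definition boxexp (G H : ihgraph) : ihgraph := {|
  vert := hom G H;
  edge := vert G -> edge H;
  inc := hom (box G Idiam1) H;
  ivert := fun psi =>
    hom_comp psi (hom_comp (box_hom (hom_id G) Yy) (runit_inv G));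
  iedge := fun psi v => hedge psi (inr (v, tt))
|}.

Section Evaluation.

Variables G H : ihgraph.

Definition vev_vert (p : vert (box G (boxexp G H))) : vert H :=
  let (v, phi) := p in hvert phi v.

Definition vev_edge (e : edge (box G (boxexp G H))) : edge H :=
  match e with
  | inl (x, phi) => hedge phi x
  | inr (x, f) => f x
  end.

Definition vev_inc (i : inc (box G (boxexp G H))) : inc H :=
  match i with
  | inl (x, phi) => hinc phi x
  | inr (x, phi) => hinc phi (inr (x, tt))
  end.

Lemma vev_ivert (i : inc (box G (boxexp G H))) :
  ivert (vev_inc i) = vev_vert (ivert i).
Proof. now destruct i as [[x phi]|[x phi]]; simpl; rewrite hom_ivert. Qed.

Lemma vev_iedge (i : inc (box G (boxexp G H))) :
  iedge (vev_inc i) = vev_edge (iedge i).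
Proof. now destruct i as [[x phi]|[x phi]]; simpl; rewrite hom_iedge. Qed.

Definition vev : hom (box G (boxexp G H)) H :=
  Hom vev_vert vev_edge vev_inc vev_ivert vev_iedge.

End Evaluation.

(* Main.v *)
(* The currying of [phi] is forced on vertices and incidences by the Yoneda
   principle: a vertex of [K] is a map V^diamond({1}) -> K and an incidence of
   [K] is a map I^diamond({1}) -> K, and the transpose of [phi] at either is
   [phi] composed with the box product of [G] with that map.  Uniqueness holds
   because an incidence of [G, H]_V is determined by its end vertex, its end
   edge and the values of its incidence map on the second summand, and the
   last are what evaluation reads off. *)
From Stdlib Require Import FunctionalExtensionality.
Require Import Defs.

Definition vertex_hom (K : ihgraph) (k : vert K) : hom Vdiam1 K :=
  @Hom Vdiam1 K
    (fun _ => k) (fun e => match e with end) (fun i => match i with end)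
    (fun i => match i with end) (fun i => match i with end).

Definition incidence_hom (K : ihgraph) (i : inc K) : hom Idiam1 K :=
  @Hom Idiam1 K (fun _ => ivert i) (fun _ => iedge i) (fun _ => i)
    (fun _ => eq_refl) (fun _ => eq_refl).

Section Transpose.

Variables (G H K : ihgraph) (phi : hom (box G K) H).

Definition transpose_vert (k : vert K) : vert (boxexp G H) :=
  hom_comp phi (hom_comp (box_hom (hom_id G) (vertex_hom K k)) (runit_inv G)).

Definition transpose_edge (e : edge K) : edge (boxexp G H) :=
  fun v => hedge phi (inr (v, e)).

Definition transpose_inc (i : inc K) : inc (boxexp G H) :=
  hom_comp phi (box_hom (hom_id G) (incidence_hom K i)).

(** Composing [incidence_hom K i] with [Yy] gives [vertex_hom K (ivert i)], so both sides agree by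
    computation up to their proof fields. *)
Lemma transpose_ivert (i : inc K) :
  ivert (transpose_inc i) = transpose_vert (ivert i).
Proof. now apply hom_ext. Qed.

Definition transpose : hom K (boxexp G H) :=
  @Hom K (boxexp G H) transpose_vert transpose_edge transpose_inc
    transpose_ivert (fun _ => eq_refl).

Lemma vev_transpose :
  hom_comp (vev G H) (box_hom (hom_id G) transpose) = phi.
Proof.
apply hom_ext.
- now intros [v k].
- now intros [[x k]|[v e]].
- now intros [[x k]|[v i]].
Qed.

End Transpose.

Lemma boxexp_inc_ext (G H : ihgraph) (p q : inc (boxexp G H)) :
  ivert p = ivert q -> iedge p = iedge q ->
  (forall v, hinc p (inr (v, tt)) = hinc q (inr (v, tt))) -> p = q.
Proof.
intros Ev Ee Ei; apply hom_ext.
(* [Ev] equates homomorphisms on [G], so it settles the vertices and both first summands. *)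
- intros [v []]; exact (f_equal (fun h : hom G H => hvert h v) Ev).
- intros [[x []]|[v []]].
  + exact (f_equal (fun h : hom G H => hedge h x) Ev).
  + exact (f_equal (fun h : vert G -> edge H => h v) Ee).
- intros [[x []]|[v []]].
  + exact (f_equal (fun h : hom G H => hinc h x) Ev).
  + apply Ei.
Qed.

Lemma vev_inj (G H K : ihgraph) (f g : hom K (boxexp G H)) :
  hom_comp (vev G H) (box_hom (hom_id G) f) =
  hom_comp (vev G H) (box_hom (hom_id G) g) -> f = g.
Proof.
intros E.
(* On vertices and first summands, [vev] reads off every component of [hvert f k]. *)
assert (Ev : forall k, hvert f k = hvert g k).
{ intros k; apply hom_ext; intros x.
  - exact (f_equal (fun h : hom (box G K) H => hvert h (x, k)) E).
  - exact (f_equal (fun h : hom (box G K) H => hedge h (inl (x, k))) E).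
  - exact (f_equal (fun h : hom (box G K) H => hinc h (inl (x, k))) E). }
assert (Ee : forall e, hedge f e = hedge g e).
{ intros e; apply functional_extensionality; intros v.
  exact (f_equal (fun h : hom (box G K) H => hedge h (inr (v, e))) E). }
apply hom_ext; trivial.
intros i; apply boxexp_inc_ext.
(* The ends of [hinc f i] are the images under [f] of the ends of [i], where [Ev] and [Ee] apply. *)
- now rewrite !hom_ivert, Ev.
- now rewrite !hom_iedge, Ee.
- intros v.
  exact (f_equal (fun h : hom (box G K) H => hinc h (inr (v, i))) E).
Qed.

Theorem mainTheorem15 (G H K : ihgraph) (phi : hom (box G K) H) :
  exists! phihat : hom K (boxexp G H),
    hom_comp (vev G H) (box_hom (hom_id G) phihat) = phi.
Proof.
exists (transpose G H K phi); split.
- apply vev_transpose.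
- intros g Eg; apply vev_inj; now rewrite vev_transpose, Eg.
Qed.
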